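(* There exists a planar triangle-free graph with $164$ vertices which is not $3$-choosable.
   Context: All graphs are finite, undirected and simple. A graph $G=(V,E)$ is $k$-choosable if for every assignment of sets $S(v)\subseteq\mathbb{Z}$ with $|S(v)|=k$ for all $v\in V$, there is a proper vertex coloring $c:V\to\mathbb{Z}$ with $c(v)\in S(v)$ for all $v\in V$. *)

(* Defs.v *)
From HB Require Import structures.
From mathcomp Require Import all_boot all_order all_algebra finmap.
From mathcomp Require Import boolp classical_sets functions set_interval reals.
From mathcomp Require Import topology normedtype.

Set Implicit Arguments.
Unset Strict Implicit.
Unset Printing Implicit Defensive.

Import Order.TTheory GRing.Theory Num.Theory.
Import numFieldNormedType.Exports.

Local Open Scope classical_set_scope.
Local Open Scope ring_scope.

Record sgraph := SGraph {
  vertex :> finType;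
  adj : rel vertex;
  adj_sym : symmetric adj;
  adj_irrefl : irreflexive adj }.

Definition triangle_free (G : sgraph) : Prop :=
  forall x y z : G, adj x y -> adj y z -> ~~ adj z x.

Definition choosable (k : nat) (G : sgraph) : Prop :=
  forall S : G -> {fset int}, (forall v, #|` S v|%fset = k) ->
  exists c : G -> int,
    (forall v, c v \in S v) /\ (forall u v, adj u v -> c u != c v).

Definition plane_arc (R : realType) (a b : R * R) (A : set (R * R)) : Prop :=
  exists f : R -> R * R,
    [/\ {within `[0, 1], continuous f},
        {in `[0, 1] &, injective f},
        f 0 = a, f 1 = b & A = f @` `[0, 1]].

(* A drawing in the plane: p places the vertices, and A E is the arc drawn for
   the edge E, an unordered pair of vertices (A is irrelevant on non-edges). *)
Definition planar (R : realType) (G : sgraph) : Prop :=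
  exists (p : G -> R * R) (A : {set G} -> set (R * R)),
    [/\ injective p,
        forall x y, adj x y -> plane_arc (p x) (p y) (A [set x; y]%SET),
        forall x y, adj x y ->
          (A [set x; y]%SET `\` [set p x; p y]) `&` range p = set0
      & forall x y u v, adj x y -> adj u v ->
          [set x; y]%SET != [set u; v]%SET ->
          (A [set x; y]%SET `\` [set p x; p y]) `&` A [set u; v]%SET = set0].

(* Main.v *)
From Stdlib Require Import ZArith.
Require Import Defs.
From mathcomp Require Import all_boot all_order all_algebra finmap.
From mathcomp Require Import classical_sets set_interval reals.
From mathcomp Require Import topology normedtype.
From mathcomp Require Import ssrZ zify ring lra.

(** Two poles [u] and [v] get the disjoint lists 0-2 and 3-5, and each of the nine
    pairs of colours [(a, b)] is excluded by its own copy of a gadget.  In it, two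
    common neighbours of [u] and [v] with list [{a, b, 6}] are forced to 6 and
    close a 4-cycle with the poles; a path [u, w, w', v] inside it, with lists
    [{a, 7, 8}] and [{b, 7, 8}], must be coloured 7, 8 or 8, 7 and cuts the
    inside into two 5-faces.  Each face contains a pentagon joined to the boundary
    by a perfect matching, with lists consisting of 9, 10 and the colour of the
    matched boundary vertex in one of the two cases; in that case the pentagon
    would have to be 2-coloured.  This uses 14 vertices per copy, and four
    isolated ones are added to reach 164 = 2 + 9 * 18.  Planarity is witnessed by a
    straight-line drawing with integer coordinates, in which any two edges are
    separated by a line, up to a common endpoint. *)

Set Implicit Arguments.
Unset Strict Implicit.
Unset Printing Implicit Defensive.

Import Order.TTheory GRing.Theory Num.Theory.
Import numFieldNormedType.Exports.

Local Open Scope classical_set_scope.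
Local Open Scope ring_scope.

(* The key [Z] delimits the scope of MathComp integers. *)
Delimit Scope Z_scope with BZ.

Lemma pairwise_neq (T : eqType) (r : rel T) (s : seq T) (x y : T) :
  pairwise r s -> x \in s -> y \in s -> x != y -> r x y || r y x.
Proof.
elim: s => //= z s IHs /andP[/allP rz rs]; rewrite !inE.
move=> /predU1P[->|xs] /predU1P[->|ys]; rewrite ?eqxx//.
- by rewrite rz.
- by rewrite rz ?orbT.
- exact: IHs.
Qed.

(** * Straight-line drawings *)

Section Segments.
Variable R : realType.
Implicit Types (a b c d z : R * R) (t : R).

Definition segment_point a b t : R * R := a + t *: (b - a).

Lemma segment_pointE a b t :
  segment_point a b t = (a.1 + t * (b.1 - a.1), a.2 + t * (b.2 - a.2)).
Proof. by []. Qed.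

Definition segment a b : set (R * R) := segment_point a b @` `[0, 1].

Lemma segment_sym a b : segment a b = segment b a.
Proof.
suff sub x y : segment x y `<=` segment y x by apply/seteqP; split; exact: sub.
move=> _ [t t01 <-]; exists (1 - t).
  by move: t01; rewrite /= !in_itv /= => ?; lra.
by rewrite !segment_pointE; congr pair; ring.
Qed.

Lemma segment_arc a b : a != b -> plane_arc a b (segment a b).
Proof.
move=> ab; exists (segment_point a b); split => //.
- apply: continuous_subspaceT => t; rewrite /segment_point.
  apply: cvgD; first exact: cvg_cst.
  by apply: cvgZ; [exact: cvg_id | exact: cvg_cst].
- move=> s t _ _ /addrI /eqP; rewrite -subr_eq0 -scalerBl scaler_eq0.
  by rewrite !subr_eq0 [b == a]eq_sym (negbTE ab) orbF => /eqP.
- by rewrite /segment_point scale0r addr0.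
- by rewrite /segment_point scale1r addrC subrK.
Qed.

(** The determinant of [v] and [p]: as a functional of [p], its level lines are parallel to [v]. *)
Definition lin (v p : R * R) : R := v.1 * p.2 - v.2 * p.1.

(** The alternative [p = q] admits segments with a common endpoint; [c = d] gives the case of a
    segment and a point. *)
Definition separated a b c d := exists v, forall p q,
  p \in [:: a; b] -> q \in [:: c; d] -> p = q \/ lin v p < lin v q.

Lemma separated_sym a b c d : separated a b c d -> separated c d a b.
Proof.
move=> [v sv]; exists (- v) => p q pcd qab.
have [->|lt_qp] := sv _ _ qab pcd; first by left.
by right; move: lt_qp; rewrite /lin /=; lra.
Qed.

(* A common point of the segments is a convex combination of [a, b] and one of
   [c, d]; comparing the values of the functional forces an endpoint. *)
Lemma separatedP a b c d : a != b -> separated a b c d ->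
  segment a b `&` segment c d `<=` [set a; b].
Proof.
move=> ab [v sv] z [] [s s01 sz] [t t01 tz].
have Fz x y r : lin v (segment_point x y r) = (1 - r) * lin v x + r * lin v y.
  by rewrite /lin segment_pointE /=; ring.
move: s01 t01; rewrite /= !in_itv /= => /andP[s0 s1] /andP[t0 t1].
have := Fz a b s; have := Fz c d t; rewrite sz tz => -> E.
have [s00|sn0] := eqVneq s 0.
  by left; rewrite -sz /segment_point s00 scale0r addr0.
have [s11|sn1] := eqVneq s 1.
  by right; rewrite -sz /segment_point s11 scale1r addrC subrK.
have {}s0 : 0 < s by rewrite lt_neqAle eq_sym sn0.
have {}s1 : s < 1 by rewrite lt_neqAle sn1.
(* As [a != b], at most one of them equals [q], and both have positive weight, so the inequality
   stays strict. *)
have mid q : q \in [:: c; d] -> (1 - s) * lin v a + s * lin v b < lin v q.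
  move=> qcd.
  have [aq|aq] := sv a q (mem_head _ _) qcd;
  have [bq|bq] := sv b q ltac:(by rewrite !inE eqxx orbT) qcd.
  - by move: ab; rewrite aq bq eqxx.
  - by rewrite aq; nra.
  - by rewrite bq; nra.
  - by nra.
have mc := mid c (mem_head _ _).
have md := mid d ltac:(by rewrite !inE eqxx orbT).
have arith (x y w r : R) : 0 <= r -> r <= 1 -> w < x -> w < y ->
    w < (1 - r) * x + r * y.
  move=> r0 r1 wx wy; have [r00|rn0] := eqVneq r 0; first by rewrite r00; lra.
  have {}r0 : 0 < r by rewrite lt_neqAle eq_sym rn0.
  by nra.
by have := arith _ _ _ _ t0 t1 mc md; rewrite E ltxx.
Qed.

End Segments.

Lemma straight_line_planar (R : realType) (G : sgraph) (p : G -> R * R) :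
  injective p ->
  (forall x y z, adj x y -> separated (p x) (p y) (p z) (p z)) ->
  (forall x y u v : G, adj x y -> adj u v -> [set x; y]%SET != [set u; v]%SET ->
     separated (p x) (p y) (p u) (p v)) ->
  planar R G.
Proof.
move=> pI vsep esep.
(* An unordered pair determines its endpoints only up to order, which is harmless by
   [segment_sym]. *)
pose A (E : {set G}) : set (R * R) :=
  [set z | exists x y, E = [set x; y]%SET /\ segment (p x) (p y) z].
have AE x y : adj x y -> A [set x; y]%SET = segment (p x) (p y).
  move=> xy; apply/seteqP; split=> [z|z]; last by exists x, y.
  move=> [u [v [E]]].
  suff [[-> ->]|[-> ->]] : u = x /\ v = y \/ u = y /\ v = x.
  - by [].
  - by rewrite segment_sym.
  have /set2P ux : u \in [set x; y]%SET by rewrite E set21.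
  have /set2P vx : v \in [set x; y]%SET by rewrite E set22.
  have /set2P xu : x \in [set u; v]%SET by rewrite -E set21.
  have /set2P yu : y \in [set u; v]%SET by rewrite -E set22.
  by move: ux vx xu yu; intuition congruence.
have pne x y : adj x y -> p x != p y.
  move=> xy; apply/negP => /eqP pxy; have E := pI _ _ pxy.
  by move: xy; rewrite E adj_irrefl.
exists p, A; split => //.
- by move=> x y xy; rewrite AE//; apply: segment_arc; exact: pne.
- move=> x y xy; rewrite AE// -subset0 => z [[zxy zn] [w _ wz]].
  apply: zn; apply: (separatedP (pne _ _ xy) (vsep x y w xy)).
  split=> //; rewrite -wz; exists 0; first by rewrite /= in_itv /= lexx ler01.
  by rewrite /segment_point scale0r addr0.
- move=> x y u v xy uv ne; rewrite !AE// -subset0 => z [[zxy zn] zuv].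
  by apply: zn; apply: (separatedP (pne _ _ xy) (esep _ _ _ _ xy uv ne)).
Qed.

(** * Separation on integer coordinates *)

Section IntegerPoints.

Definition linZ (v p : Z * Z) : Z := (v.1 * p.2 - v.2 * p.1)%BZ.

Definition eqZ2 (p q : Z * Z) : bool := Z.eqb p.1 q.1 && Z.eqb p.2 q.2.

(* Here and below, [if] replaces the boolean connectives because [vm_compute]
   would evaluate both arguments of the latter. *)
Definition below_or_eq (p : Z * Z) (x : Z) (q : Z * Z) (y : Z) : bool :=
  if Z.ltb x y then true else eqZ2 p q.

(** Both orders are tested, so that [v] matters only up to sign. *)
Definition separates (a b c d v : Z * Z) : bool :=
  let fa := linZ v a in let fb := linZ v b in
  let fc := linZ v c in let fd := linZ v d in
  if [&& below_or_eq a fa c fc, below_or_eq a fa d fd,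
         below_or_eq b fb c fc & below_or_eq b fb d fd] then true
  else [&& below_or_eq c fc a fa, below_or_eq d fd a fa,
           below_or_eq c fc b fb & below_or_eq d fd b fb].

Definition subZ2 (p q : Z * Z) : Z * Z := ((p.1 - q.1)%BZ, (p.2 - q.2)%BZ).

(* Two disjoint segments are separated along one of their own directions or
   along an axis; the sum and the difference of the directions handle segments
   with a common endpoint. *)
Definition separatedZ (e f : (Z * Z) * (Z * Z)) : bool :=
  let: (a, b) := e in let: (c, d) := f in
  let u := subZ2 b a in let w := subZ2 d c in
  if separates a b c d (0, 1)%BZ then true else
  if separates a b c d (1, 0)%BZ then true else
  if separates a b c d u then true else
  if separates a b c d w then true else
  if separates a b c d (subZ2 u w) then true else
  separates a b c d (subZ2 u (subZ2 c d)).

Variable R : realType.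

Definition ofZ (z : Z) : R := (int_of_Z z)%:~R.
Definition ofZ2 (p : Z * Z) : R * R := (ofZ p.1, ofZ p.2).

Lemma ofZ_inj : injective ofZ.
Proof. by move=> x y /intr_inj /(can_inj int_of_ZK). Qed.

Lemma ofZ2_inj : injective ofZ2.
Proof. by move=> [x y] [z t] [] /ofZ_inj -> /ofZ_inj ->. Qed.

Lemma ofZ_lin (v p : Z * Z) : ofZ (linZ v p) = lin (ofZ2 v) (ofZ2 p).
Proof. by rewrite /linZ /ofZ /lin /= -!rmorphM -!rmorphB. Qed.

Lemma ofZ_lt (x y : Z) : Z.ltb x y -> ofZ x < ofZ y.
Proof. by rewrite /ofZ ltr_int; lia. Qed.

Lemma separatesP (a b c d v : Z * Z) : separates a b c d v ->
  separated (ofZ2 a) (ofZ2 b) (ofZ2 c) (ofZ2 d).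
Proof.
have belowP p q : below_or_eq p (linZ v p) q (linZ v q) ->
    ofZ2 p = ofZ2 q \/ lin (ofZ2 v) (ofZ2 p) < lin (ofZ2 v) (ofZ2 q).
  rewrite /below_or_eq; case: ifP => [/ofZ_lt|_].
    by rewrite !ofZ_lin; right.
  move=> /andP[/Z.eqb_spec pq1 /Z.eqb_spec pq2].
  by left; rewrite /ofZ2 pq1 pq2.
rewrite /separates; case: ifP => [/and4P[]|_ /and4P[]];
  move=> /belowP ac /belowP ad /belowP bc /belowP bd; last apply: separated_sym;
  exists (ofZ2 v) => p q; rewrite !inE; by move=> /orP[]/eqP-> /orP[]/eqP->.
Qed.

Lemma separatedZP (a b c d : Z * Z) : separatedZ (a, b) (c, d) ->
  separated (ofZ2 a) (ofZ2 b) (ofZ2 c) (ofZ2 d).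
Proof.
rewrite /separatedZ; do 5![case: ifP => [/separatesP//|_]].
exact: separatesP.
Qed.

End IntegerPoints.

(** * The graph *)

(* Vertices 0 and 1 are the poles [u] and [v]; copy [i] of the gadget has its
   own vertices numbered from [2 + 18 i].  Inside the gadget, 18 and 19 stand for
   [u] and [v], 0 and 1 for the other two vertices of the boundary 4-cycle, 2 and
   3 for the inner vertices of the path from [u] to [v], 4-8 and 9-13 for the two
   pentagons, and 14-17 are isolated. *)
Definition gadget_edges : seq (nat * nat) :=
  [:: (18, 0); (0, 19); (18, 1); (1, 19); (18, 2); (2, 3); (3, 19);
      (4, 5); (5, 6); (6, 7); (7, 8); (8, 4);
      (9, 10); (10, 11); (11, 12); (12, 13); (13, 9);
      (4, 18); (5, 2); (6, 3); (7, 19); (8, 0);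
      (9, 18); (10, 2); (11, 3); (12, 19); (13, 1)]%N.

Definition in_copy (i k : nat) : nat :=
  (if k < 18 then 2 + (i * 18 + k) else k - 18)%N.

Definition edges : seq (nat * nat) :=
  [seq (in_copy i e.1, in_copy i e.2) | i <- iota 0 9, e <- gadget_edges].

Definition edge (x y : nat) : bool := ((x, y) \in edges) || ((y, x) \in edges).

Lemma edges_irrefl : all (fun e => e.1 != e.2) edges.
Proof. by vm_compute. Qed.

Lemma edge_sym : symmetric (fun x y : 'I_164 => edge x y).
Proof. by move=> x y; rewrite /edge orbC. Qed.

Lemma edge_irrefl : irreflexive (fun x y : 'I_164 => edge x y).
Proof.
move=> x; rewrite /edge orbb; apply/negP => /(allP edges_irrefl).
by rewrite /= eqxx.
Qed.

Definition graph : sgraph := SGraph edge_sym edge_irrefl.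

Definition all_edges := edges ++ [seq (e.2, e.1) | e <- edges].

Lemma edgeE x y : edge x y = ((x, y) \in all_edges).
Proof.
rewrite [RHS]mem_cat; congr orb.
apply/idP/idP => [yx|/mapP[[a b] ab [-> ->]]//].
by apply/mapP; exists (y, x).
Qed.

Definition neighbors (E : seq (nat * nat)) (x : nat) : seq nat :=
  [seq e.2 | e <- E & e.1 == x].

Lemma mem_neighbors E x y : (y \in neighbors E x) = ((x, y) \in E).
Proof.
apply/mapP/idP => [[[a b]]|xy].
  by rewrite mem_filter /= => /andP[/eqP <- ab] ->.
by exists (x, y); rewrite // mem_filter /= eqxx.
Qed.

(** For symmetric [E] this is triangle-freeness, tested edge by edge instead of on all triples. *)
Definition no_common_neighbor (E : seq (nat * nat)) : bool :=
  all (fun e => ~~ has (mem (neighbors E e.1)) (neighbors E e.2)) E.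

Lemma no_common_neighborP E x y z : no_common_neighbor E ->
  (x, y) \in E -> (y, z) \in E -> (x, z) \notin E.
Proof.
move=> /allP nE /nE /hasPn/(_ z).
by rewrite /= !mem_neighbors; apply.
Qed.

Lemma all_edges_no_common_neighbor : no_common_neighbor all_edges.
Proof. by vm_compute. Qed.

Lemma graph_triangle_free : triangle_free graph.
Proof.
move=> x y z xy yz; rewrite adj_sym; move: xy yz; rewrite /adj /= !edgeE.
exact: no_common_neighborP all_edges_no_common_neighbor.
Qed.

(** * The drawing *)

Definition gadget_position (k : nat) : Z * Z :=
  nth (0, 0)%BZ
    [:: (-6, 0); (6, 0); (0, 0); (0, -4);
        (-2, 4); (-2, 0); (-2, -3); (-2, -6); (-4, 0);
        (2, 4); (2, 0); (2, -3); (2, -6); (4, 0);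
        (-1, 1); (-1, 2); (1, 1); (1, 2)]%BZ k.

(* The poles are at [(0, 12)] and [(0, -12)].  No edge of the gadget crosses the
   horizontal axis, so shearing each of the two half-planes along the axis, with
   the poles fixed, makes disjoint straight-line copies. *)
Definition position (n : nat) : Z * Z :=
  if n is n'.+2 then
    let: (x, y) := gadget_position (n' %% 18) in
    ((x + Z.of_nat (2 * (n' %/ 18)) * (12 - Z.abs y))%BZ, y)
  else if n is 1%N then (0, -12)%BZ else (0, 12)%BZ.

Definition segment_of (e : nat * nat) : (Z * Z) * (Z * Z) :=
  (position e.1, position e.2).

Lemma segments_separatedP (R : realType) (E : seq (nat * nat)) e f :
  pairwise separatedZ (map segment_of E) -> e \in E -> f \in E -> e != f ->
  separated (ofZ2 R (position e.1)) (ofZ2 R (position e.2))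
            (ofZ2 R (position f.1)) (ofZ2 R (position f.2)).
Proof.
rewrite pairwise_map => sep eE fE ne.
case/orP: (pairwise_neq sep eE fE ne) => /separatedZP; first exact.
by move=> /(_ R)/separated_sym.
Qed.

Lemma points_separatedP (R : realType) (E : seq (nat * nat)) (s : seq nat) e n :
  allrel (fun e z => separatedZ e (z, z)) (map segment_of E) (map position s) ->
  e \in E -> n \in s ->
  separated (ofZ2 R (position e.1)) (ofZ2 R (position e.2))
            (ofZ2 R (position n)) (ofZ2 R (position n)).
Proof.
move=> /allrelP sep eE ns; apply: separatedZP.
by apply: (sep (segment_of e)); apply: map_f.
Qed.

Lemma positions_uniq : uniq (map position (iota 0 164)).
Proof. by vm_compute. Qed.

Lemma points_separated :
  allrel (fun e z => separatedZ e (z, z))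
    (map segment_of edges) (map position (iota 0 164)).
Proof. by vm_compute. Qed.

Lemma segments_separated : pairwise separatedZ (map segment_of edges).
Proof. by vm_compute. Qed.

Lemma graph_planar (R : realType) : planar R graph.
Proof.
pose p (x : graph) : R * R := ofZ2 R (position (x : 'I_164)).
have esep (x y u v : graph) :
    (val x, val y) \in edges -> (val u, val v) \in edges ->
    [set x; y]%SET != [set u; v]%SET -> separated (p x) (p y) (p u) (p v).
  move=> xy uv ne; have := segments_separatedP R segments_separated xy uv.
  by apply; apply: contraNneq ne => -[/val_inj -> /val_inj ->].
(* [edges] stores one orientation of each edge; the two swaps supply the others. *)
have swap1 (a b c d : R * R) : separated a b c d -> separated b a c d.
  move=> [v sv]; exists v => s t; rewrite !inE orbC => sab tcd.
  by apply: sv; rewrite !inE.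
have swap2 (a b c d : R * R) : separated a b c d -> separated a b d c.
  by move=> /separated_sym/swap1/separated_sym.
apply: (@straight_line_planar R graph p).
- move=> x y /ofZ2_inj E; apply: val_inj.
  have := nth_uniq (0, 0)%BZ _ _ positions_uniq; rewrite !size_map !size_iota.
  move=> /(_ x y (ltn_ord x) (ltn_ord y)).
  rewrite !(nth_map 0%N) ?size_iota// !nth_iota// !add0n E eqxx.
  by move=> /esym/eqP.
- have vsep (x y z : graph) : (val x, val y) \in edges ->
      separated (p x) (p y) (p z) (p z).
    move=> xy; apply: (points_separatedP R points_separated xy).
    by rewrite mem_iota /= ltn_ord.
  by move=> x y z /orP[/vsep|/vsep/swap1]; exact.
- move=> x y u v /orP[]xy /orP[]uv ne; last apply: swap1.
  + exact: esep.
  + by apply: swap2; apply: esep; rewrite // [X in _ != X]finset.setUC.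
  + by apply: swap1; apply: esep; rewrite // [X in X != _]finset.setUC.
  + apply: swap2; apply: esep => //.
    by rewrite finset.setUC [X in _ != X]finset.setUC.
Qed.

(** * The lists *)

(** The pentagon 4-8 is meant for the colours 7, 8 of the vertices 2 and 3, the pentagon 9-13 for 8,
    7. *)
Definition gadget_lists (a b : nat) : seq (seq nat) :=
  [:: [:: a; b; 6]; [:: a; b; 6]; [:: a; 7; 8]; [:: b; 7; 8];
      [:: 9; 10; a]; [:: 9; 10; 7]; [:: 9; 10; 8]; [:: 9; 10; b];
      [:: 9; 10; 6];
      [:: 9; 10; a]; [:: 9; 10; 8]; [:: 9; 10; 7]; [:: 9; 10; b];
      [:: 9; 10; 6]]%N.

(** Excluding [e k], the colour of the vertex matched to vertex [k], leaves only [s] and [t], and an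
    odd cycle has no proper 2-colouring. *)
Lemma pentagon_not_2_colorable (T : eqType) (s t : T) (e z : nat -> T) :
  (forall k, (k < 5)%N -> z k \in [:: s; t; e k] /\ z k != e k) ->
  [|| z 0 == z 1, z 1 == z 2, z 2 == z 3, z 3 == z 4 | z 4 == z 0]%N.
Proof.
move=> H.
have st k : (k < 5)%N -> (z k == s) || (z k == t).
  by move=> /H[zL /negbTE ze]; move: zL; rewrite !inE ze orbF.
case/orP: (st 0%N isT) => /eqP->; case/orP: (st 1%N isT) => /eqP->;
case/orP: (st 2%N isT) => /eqP->; case/orP: (st 3%N isT) => /eqP->;
by case/orP: (st 4%N isT) => /eqP->; rewrite !eqxx ?orbT.
Qed.

Lemma gadget_not_colorable (a b : nat) (f : nat -> int) :
  f 18%N = a -> f 19%N = b ->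
  (forall k, (k < 14)%N -> f k \in map Posz (nth [::] (gadget_lists a b) k)) ->
  ~ all (fun e => f e.1 != f e.2) gadget_edges.
Proof.
move=> fu fv fL /allP fE.
have ne k l : (k, l) \in gadget_edges -> f k != f l by move=> /fE.
have fx : f 0%N = Posz 6.
  have := fL 0%N isT; rewrite !inE -fu -fv [f 0%N == _]eq_sym.
  by rewrite (negbTE (ne 18 0 isT)%N) (negbTE (ne 0 19 isT)%N) => /eqP.
have fy : f 1%N = Posz 6.
  have := fL 1%N isT; rewrite !inE -fu -fv [f 1%N == _]eq_sym.
  by rewrite (negbTE (ne 18 1 isT)%N) (negbTE (ne 1 19 isT)%N) => /eqP.
have fw : (f 2%N == Posz 7) || (f 2%N == Posz 8).
  have := fL 2%N isT; rewrite !inE -fu [f 2%N == f _]eq_sym.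
  by rewrite (negbTE (ne 18 2 isT)%N).
have fw' : (f 3%N == Posz 7) || (f 3%N == Posz 8).
  by have := fL 3%N isT; rewrite !inE -fv (negbTE (ne 3 19 isT)%N).
(* [m] is the first vertex of a pentagon, and [c] lists the colours of the boundary vertices matched
   to it. *)
have pentagon m c : (m == 4) || (m == 9) ->
    all (fun k => (nth [::] (gadget_lists a b) (m + k) == [:: 9; 10; nth 0 c k])
                  && (f (m + k) != nth 0 c k))%N (iota 0 5) ->
    False.
  move=> m49 /allP cP.
  have H k : (k < 5)%N ->
      f (m + k)%N \in [:: Posz 9; Posz 10; Posz (nth 0%N c k)] /\
      f (m + k)%N != Posz (nth 0%N c k).
    move=> k5; have /andP[/eqP E ?] := cP k ltac:(by rewrite mem_iota).
    split=> //; have := fL (m + k)%N; rewrite E; apply.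
    by case/orP: m49 => /eqP ->; lia.
  have := pentagon_not_2_colorable H.
  by case/orP: m49 => /eqP ->; rewrite !(negbTE (ne _ _ _)).
case/orP: fw => /eqP f2; case/orP: fw' => /eqP f3.
- by have := ne 2%N 3%N isT; rewrite f2 f3.
- apply: (pentagon 4%N [:: a; 7; 8; b; 6]%N isT) => /=.
  by rewrite !eqxx /= -f2 -f3 -fu -fv -fx !ne.
- apply: (pentagon 9%N [:: a; 8; 7; b; 6]%N isT) => /=.
  by rewrite !eqxx /= -f2 -f3 -fu -fv -fy !ne.
- by have := ne 2%N 3%N isT; rewrite f2 f3.
Qed.

(** Copy [i] serves the pole colours [i %/ 3] and [3 + i %% 3]. The default of [nth] is the list of
    the isolated vertices 14-17. *)
Definition colors (n : nat) : seq nat :=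
  if n is n'.+2 then
    nth [:: 0; 1; 2]%N
      (gadget_lists (n' %/ 18 %/ 3) (3 + n' %/ 18 %% 3)) (n' %% 18)
  else if n is 1%N then [:: 3; 4; 5]%N else [:: 0; 1; 2]%N.

Lemma colors_uniq_size3 :
  all (fun n => uniq (colors n) && (size (colors n) == 3%N)) (iota 0 164).
Proof. by vm_compute. Qed.

Lemma colors_in_copy (i k : nat) : (k < 14)%N ->
  colors (in_copy i k) = nth [::] (gadget_lists (i %/ 3) (3 + i %% 3)) k.
Proof.
move=> k14; have k18 : (k < 18)%N by apply: leq_trans k14 _.
rewrite /in_copy k18 /= divnMDl// modnMDl (divn_small k18) (modn_small k18).
rewrite addn0.
exact: set_nth_default.
Qed.

Lemma edges_lt : all (fun e => (e.1 < 164) && (e.2 < 164))%N edges.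
Proof. by vm_compute. Qed.

Lemma graph_not_3_choosable : ~ choosable 3 graph.
Proof.
pose S (x : graph) : {fset int} :=
  [fset y in map Posz (colors (x : 'I_164))]%fset.
move=> /(_ S)[x|c [cS cE]].
  have /(allP colors_uniq_size3)/andP[u3 /eqP s3] : val x \in iota 0 164.
    by rewrite mem_iota /= ltn_ord.
  by rewrite card_fseq undup_id ?size_map// map_inj_uniq// => ? ? [].
pose f (n : nat) : int := c (inord n : 'I_164).
have fL n : (n < 164)%N -> f n \in map Posz (colors n).
  by move=> n164; have := cS (inord n : 'I_164); rewrite !inE /= inordK.
have fE e : e \in edges -> f e.1 != f e.2.
  move=> eE; have /andP[lt1 lt2] := allP edges_lt e eE.
  by apply: cE; rewrite /= /edge !inordK// -surjective_pairing eE.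
have /mapP[a aL fa] := fL 0%N isT; have /mapP[b bL fb] := fL 1%N isT.
(* The copy that [colors] assigns to the pole colours [a] and [b]. *)
pose i := (a * 3 + (b - 3))%N.
have [i9 ia ib] : [/\ i < 9, i %/ 3 = a & 3 + i %% 3 = b]%N.
  move: aL bL; rewrite /= !inE.
  by move=> /or3P[]/eqP Ea /or3P[]/eqP Eb; rewrite /i Ea Eb.
(* [in_copy i] sends 18 and 19 to the poles 0 and 1, whatever [i] is. *)
apply: (@gadget_not_colorable a b (f \o in_copy i)) => //.
- move=> k k14; rewrite -ia -ib -colors_in_copy//; apply: fL.
  by rewrite /in_copy (leq_trans k14)//; lia.
- apply/allP => e eE /=; apply: (fE (in_copy i e.1, in_copy i e.2)).
  apply/allpairsP; exists (i, e); split=> //.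
  by rewrite mem_iota.
Qed.

Local Close Scope ring_scope.
Local Close Scope classical_set_scope.

Theorem theorem1p8 (R : realType) :
  exists G : sgraph,
    [/\ #|G| = 164, planar R G, triangle_free G & ~ choosable 3 G].
Proof.
exists graph; split.
- exact: card_ord.
- exact: graph_planar.
- exact: graph_triangle_free.
- exact: graph_not_3_choosable.
Qed.
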